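(* Let $(X,Q,\pi)$ be a finite Markov chain (with the arithmetic mean). Then $X$ is Lichnerowicz sharp if and only if $\mathbf{1}_X$ is an optimal measure for dimension $n=\infty$.
   Context: A finite Markov chain $(X,Q,\pi)$ is always assumed irreducible and reversible: $X$ is a finite set, $Q:X\times X\to[0,1]$ satisfies $\sum_{y}Q(x,y)=1$ for all $x$ and is irreducible, $\pi\in(0,1]^X$ is the unique stationary probability measure, and $Q(x,y)\pi(x)=Q(y,x)\pi(y)$ for all $x,y$. For $f,g\in\mathbb{R}^X$ put $\langle f,g\rangle_\pi=\sum_{x}f(x)g(x)\pi(x)$, $\Delta f(x)=\sum_{y}(f(y)-f(x))Q(x,y)$, $2\Gamma(f,g)=\Delta(fg)-f\Delta g-g\Delta f$, $2\Gamma_2(f,g)=\Delta\Gamma(f,g)-\Gamma(f,\Delta g)-\Gamma(g,\Delta f)$, $\Gamma f=\Gamma(f,f)$, $\Gamma_2f=\Gamma_2(f,f)$. For $n\in(0,\infty]$ (with $\frac1n=0$ if $n=\infty$), $K_n(X)$ is the supremum of all $K\in\mathbb{R}$ such that $\langle\rho,\Gamma_2f-\frac1n(\Delta f)^2-K\Gamma f\rangle_\pi\ge0$ for all $\rho\in[0,\infty)^X$ and all $f\in\mathbb{R}^X$. A measure $\rho\in[0,\infty)^X$ is optimal for dimension $n$ if there exists $f_0\in\mathbb{R}^X$ with $\Gamma f_0>0$ on $\mathrm{supp}\,\rho=\{x:\rho(x)>0\}$ and $\langle\rho,\Gamma_2f_0-\frac1n(\Delta f_0)^2-K_n(X)\Gamma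 f_0\rangle_\pi=0$. $\mathbf{1}_X$ is the measure with $\mathbf{1}_X(x)=1$ for all $x$. With $\lambda_1(X)$ the smallest positive eigenvalue of $-\Delta$, $X$ is Lichnerowicz sharp (for the arithmetic mean) if $\lambda_1(X)=K_\infty(X)$. *)

(* Defs.v *)
From HB Require Import structures.
From mathcomp Require Import all_boot all_order all_algebra.
From mathcomp Require Import classical_sets reals ereal.

Set Implicit Arguments.
Unset Strict Implicit.
Unset Printing Implicit Defensive.

Import Order.TTheory GRing.Theory Num.Theory.

Local Open Scope classical_set_scope.
Local Open Scope ring_scope.

Definition stationary (R : realType) (X : finType) (Q : X -> X -> R)
    (mu : X -> R) : Prop :=
  [/\ forall x, 0 <= mu x, \sum_x mu x = 1
    & forall y, \sum_x mu x * Q x y = mu y].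

Record markov_chain (R : realType) (X : finType) := MarkovChain {
  mc_Q : X -> X -> R;
  mc_pi : X -> R;
  mc_Q01 : forall x y, 0 <= mc_Q x y <= 1;
  mc_Qsum : forall x, \sum_y mc_Q x y = 1;
  mc_irreducible : forall x y, connect (fun u v => 0 < mc_Q u v) x y;
  mc_pi01 : forall x, 0 < mc_pi x <= 1;
  mc_stationary : stationary mc_Q mc_pi;
  mc_unique : forall mu, stationary mc_Q mu -> mu =1 mc_pi;
  mc_reversible : forall x y, mc_Q x y * mc_pi x = mc_Q y x * mc_pi y }.

Section Curvature.
Variables (R : realType) (X : finType) (M : markov_chain R X).
Implicit Types (f g rho : X -> R) (n : \bar R) (K l : R).

Definition inner f g : R := \sum_x f x * g x * mc_pi M x.

Definition laplacian f : X -> R := fun x => \sum_y (f y - f x) * mc_Q M x y.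

Definition Gamma f g : X -> R := fun x =>
  (laplacian (f \* g) x - f x * laplacian g x - g x * laplacian f x) / 2.

Definition Gamma2 f g : X -> R := fun x =>
  (laplacian (Gamma f g) x - Gamma f (laplacian g) x
   - Gamma g (laplacian f) x) / 2.

(* The inverse on [\bar R] satisfies [+oo^-1 = 0], so [fine n^-1] is 1/n with
   the convention 1/oo = 0; only 0 < n is meaningful. *)
Definition curvature_defect n K f : X -> R := fun x =>
  Gamma2 f f x - fine (n^-1)%E * laplacian f x ^+ 2 - K * Gamma f f x.

Definition curvature_dimension n K : Prop :=
  forall rho f, (forall x, 0 <= rho x) -> 0 <= inner rho (curvature_defect n K f).

(* Extended-real valued: it is +oo when X is a point, since then Gamma = 0. *)
Definition curvature n : \bar R :=
  ereal_sup [set K%:E | K in [set K | curvature_dimension n K]].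

Definition optimal n rho : Prop :=
  (forall x, 0 <= rho x) /\
  exists K f0,
    [/\ curvature n = K%:E,
        forall x, 0 < rho x -> 0 < Gamma f0 f0 x
      & inner rho (curvature_defect n K f0) = 0].

Definition eigenvalue_neg_laplacian l : Prop :=
  exists f, (exists x, f x != 0) /\ forall x, - laplacian f x = l * f x.

Definition smallest_positive_eigenvalue l : Prop :=
  [/\ 0 < l, eigenvalue_neg_laplacian l
    & forall l', 0 < l' -> eigenvalue_neg_laplacian l' -> l <= l'].

(* Existence of the smallest positive eigenvalue is part of the definition:
   a one-point chain has no positive eigenvalue and is not sharp. *)
Definition lichnerowicz_sharp : Prop :=
  exists l, smallest_positive_eigenvalue l /\ l%:E = curvature +oo%E.

End Curvature.

(* Main.v *)
Require Import Defs.
From mathcomp Require Import all_boot all_order all_algebra.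
From mathcomp Require Import classical_sets reals ereal.
From mathcomp Require Import boolp constructive_ereal ring lra.

(** Integrating against the stationary measure turns both iterated gradients
    into spectral quantities: self-adjointness of the Laplacian [D] gives
    [<1, Gamma f> = - <f, D f>] and [<1, Gamma2 f> = <D f, D f>].  Hence, for
    infinite dimension, the integrated defect of [f] at level [K] is the
    quadratic form [<D f, D f> + K <f, D f>] ([inner_one_defect]), and it is
    nonnegative when [K] is the curvature, because the supremum defining the
    curvature is attained ([curvature_attained]).

    If [1] is optimal with test function [f0], this nonnegative form vanishes
    at [f0], so [f0] lies in its radical: [D (D f0) + K D f0 = 0]
    ([defect_radical]).  Thus [D f0], which is not zero since [Gamma f0 > 0],
    is an eigenfunction with eigenvalue [K], and [K > 0] because
    [K <f0, - D f0> = <D f0, D f0>].  The form takes the value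
    [l (l - K) <g, g>] at an eigenfunction [g] for [l], so no positive
    eigenvalue lies below [K].

    Conversely, let [f] be an eigenfunction for [l = K].  The form vanishes at
    [f], so optimality only requires [Gamma f > 0] everywhere.  The defect is
    pointwise nonnegative and integrates to zero, so it is zero pointwise;
    inserting [D f = - l f] into it leaves [D (Gamma f) = 0].  Harmonic
    functions are constant by irreducibility, and the constant value of
    [Gamma f] cannot be [0], for otherwise [f] would be constant and its eigenvalue [0]. *)

Set Implicit Arguments.
Unset Strict Implicit.
Unset Printing Implicit Defensive.

Import Order.TTheory GRing.Theory Num.Theory.

Section MarkovChain.
Local Open Scope ring_scope.
Variables (R : realType) (X : finType) (M : markov_chain R X).
Implicit Types (f g h rho : X -> R) (K l : R).

Local Notation D := (laplacian M).
Local Notation one := (fun _ : X => 1 : R).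

(** * Integration against the stationary measure *)

Lemma mc_pi_gt0 x : 0 < mc_pi M x.
Proof. by case/andP: (mc_pi01 M x). Qed.

Lemma mc_Q_ge0 x y : 0 <= mc_Q M x y.
Proof. by case/andP: (mc_Q01 M x y). Qed.

Lemma mc_inhabited : exists x : X, true.
Proof.
case: (pickP (@predT X)) => [x _|X0]; first by exists x.
have [_ + _] := mc_stationary M.
by rewrite big_pred0 // => /eqP; rewrite eq_sym oner_eq0.
Qed.

Lemma innerC f g : inner M f g = inner M g f.
Proof. by apply: eq_bigr => x _; rewrite (mulrC (f x)). Qed.

Lemma innerDZr f g h K :
  inner M f (fun x => g x + K * h x) = inner M f g + K * inner M f h.
Proof.
rewrite /inner mulr_sumr -big_split; apply: eq_bigr => x _ /=.
by rewrite mulrDr mulrDl mulrCA -!mulrA.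
Qed.

Lemma inner_ge0 f g :
  (forall x, 0 <= f x) -> (forall x, 0 <= g x) -> 0 <= inner M f g.
Proof.
by move=> f0 g0; apply: sumr_ge0 => x _; rewrite !mulr_ge0 // ltW ?mc_pi_gt0.
Qed.

Lemma inner_one_eq0 f :
  (forall x, 0 <= f x) -> inner M one f = 0 -> forall x, f x = 0.
Proof.
move=> f0 If x.
have /(_ x isT) /eqP : forall x, true -> 1 * f x * mc_pi M x = 0.
  apply: psumr_eq0P => // y _.
  by rewrite mul1r mulr_ge0 // ltW ?mc_pi_gt0.
by rewrite mul1r mulf_eq0 (gt_eqF (mc_pi_gt0 x)) orbF => /eqP.
Qed.

Lemma inner_gt0_one f : (forall x, 0 < f x) -> 0 < inner M one f.
Proof.
move=> f0; rewrite lt_neqAle inner_ge0 //; last by move=> x; rewrite ltW.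
rewrite andbT eq_sym; apply/eqP => If.
have [x _] := mc_inhabited.
have := inner_one_eq0 (fun x => ltW (f0 x)) If x.
by apply/eqP; rewrite gt_eqF.
Qed.

Lemma inner_self_ge0 f : 0 <= inner M f f.
Proof.
by apply: sumr_ge0 => x _; rewrite mulr_ge0 ?sqr_ge0 // ltW ?mc_pi_gt0.
Qed.

Lemma inner_self_eq0 f : inner M f f = 0 -> forall x, f x = 0.
Proof.
move=> If x.
suff /(_ x) /eqP : forall x, f x * f x = 0 by rewrite mulf_eq0 orbb => /eqP.
apply: (@inner_one_eq0 (f \* f)) => [y|]; first exact: sqr_ge0.
by rewrite -If; apply: eq_bigr => y _ /=; rewrite mul1r.
Qed.

Lemma inner_self_gt0 f x : f x != 0 -> 0 < inner M f f.
Proof.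
move=> fx; rewrite lt_neqAle inner_self_ge0 andbT eq_sym.
by apply: contraNneq fx => /inner_self_eq0 ->.
Qed.

(** * The Laplacian *)

Lemma laplacianE f x : D f x = \sum_y mc_Q M x y * f y - f x.
Proof.
rewrite /laplacian -[f x in RHS]mulr1 -(mc_Qsum M x) mulr_sumr -sumrB.
by apply: eq_bigr => y _; rewrite mulrBl mulrC.
Qed.

Lemma laplacianDZ f g K x :
  D (fun y => f y + K * g y) x = D f x + K * D g x.
Proof.
rewrite /laplacian mulr_sumr -big_split; apply: eq_bigr => y _ /=.
by ring.
Qed.

(** Reversibility says exactly that the Laplacian is self-adjoint. *)
Lemma laplacian_selfadjoint f g : inner M f (D g) = inner M (D f) g.
Proof.
have E u v : inner M u (D v) =
    \sum_x \sum_y u x * v y * (mc_Q M x y * mc_pi M x) - inner M u v.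
  rewrite /inner -sumrB; apply: eq_bigr => x _.
  rewrite laplacianE mulrBr mulrBl mulr_sumr mulr_suml; congr (_ - _).
  by apply: eq_bigr => y _; ring.
rewrite (innerC (D f)) !E (innerC g); congr (_ - _).
rewrite exchange_big; apply: eq_bigr => y _; apply: eq_bigr => x _.
by rewrite mc_reversible (mulrC (f x)).
Qed.

Lemma inner_one_laplacian f : inner M one (D f) = 0.
Proof.
rewrite laplacian_selfadjoint; apply: big1 => x _.
by rewrite /laplacian big1 ?mul0r // => y _; rewrite subrr mul0r.
Qed.

(** * The carre du champ and harmonic functions *)

Lemma GammaE f g x :
  Gamma M f g x = (\sum_y (f y - f x) * (g y - g x) * mc_Q M x y) / 2.
Proof.
rewrite /Gamma /laplacian; congr (_ / _).
rewrite !mulr_sumr -!sumrB; apply: eq_bigr => y _ /=; ring.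
Qed.

Lemma Gamma_ge0 f x : 0 <= Gamma M f f x.
Proof.
rewrite GammaE divr_ge0 //; apply: sumr_ge0 => y _.
by rewrite mulr_ge0 ?sqr_ge0 ?mc_Q_ge0.
Qed.

Lemma GammaZr f g K x :
  Gamma M f (fun y => K * g y) x = K * Gamma M f g x.
Proof.
rewrite !GammaE mulrA mulr_sumr; congr (_ / _).
by apply: eq_bigr => y _; ring.
Qed.

(** Integration by parts. *)
Lemma inner_one_Gamma f g : inner M one (Gamma M f g) = - inner M f (D g).
Proof.
have -> : inner M one (Gamma M f g) =
    (inner M one (D (f \* g)) - inner M f (D g) - inner M g (D f)) / 2.
  rewrite /inner -!sumrB mulr_suml; apply: eq_bigr => x _.
  by rewrite /Gamma; ring.
by rewrite inner_one_laplacian (innerC g) -laplacian_selfadjoint; field.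
Qed.

Lemma Gamma_eq0_const f :
  (forall x, Gamma M f f x = 0) -> forall x y, f x = f y.
Proof.
move=> G0 x y.
have step u v : 0 < mc_Q M u v -> f u = f v.
  move=> Quv; move: (G0 u); rewrite GammaE => /eqP.
  rewrite mulf_eq0 invr_eq0 pnatr_eq0 orbF => /eqP S0.
  have /(_ v isT)/eqP : forall w, true ->
      (f w - f u) * (f w - f u) * mc_Q M u w = 0.
    by apply: psumr_eq0P => // w _; rewrite mulr_ge0 ?sqr_ge0 ?mc_Q_ge0.
  by rewrite mulf_eq0 (gt_eqF Quv) orbF mulf_eq0 orbb subr_eq0 => /eqP.
have /connectP[p + ->] := mc_irreducible M x y.
elim: p x => //= z p IH x /andP[Qxz pth].
by rewrite (step _ _ Qxz); apply: IH.
Qed.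

Lemma laplacian_const f : (forall x y, f x = f y) -> forall x, D f x = 0.
Proof.
by move=> fc x; apply: big1 => y _; rewrite (fc y x) subrr mul0r.
Qed.

(** The Dirichlet energy of a harmonic function vanishes. *)
Lemma harmonic_const f : (forall x, D f x = 0) -> forall x y, f x = f y.
Proof.
move=> Df; apply: Gamma_eq0_const; apply: inner_one_eq0.
  exact: Gamma_ge0.
rewrite inner_one_Gamma /inner big1 ?oppr0 // => x _.
by rewrite Df mulr0 mul0r.
Qed.

(** * The curvature bound and its integrated form *)

Lemma curvature_defect_oo K f x :
  curvature_defect M +oo%E K f x = Gamma2 M f f x - K * Gamma M f f x.
Proof. by rewrite /curvature_defect invey mul0r subr0. Qed.

(** The Bochner identity: [Gamma2] integrates to the squared norm of the
    Laplacian. *)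
Lemma inner_one_defect K f : inner M one (curvature_defect M +oo%E K f) =
  inner M (D f) (D f) + K * inner M f (D f).
Proof.
have -> : inner M one (curvature_defect M +oo%E K f) =
    inner M one (D (Gamma M f f)) / 2 - inner M one (Gamma M f (D f))
    - K * inner M one (Gamma M f f).
  rewrite /inner mulr_suml mulr_sumr -!sumrB; apply: eq_bigr => x _.
  by rewrite curvature_defect_oo /Gamma2; field.
rewrite inner_one_laplacian !inner_one_Gamma laplacian_selfadjoint; ring.
Qed.

(** The condition on [K] is a family of affine inequalities [K * b <= a] with
    [b >= 0], so it passes to the supremum. *)
Lemma curvature_attained n K :
  curvature M n = K%:E -> curvature_dimension M n K.
Proof.
move=> curvK rho f rho0.
set b := inner M rho (Gamma M f f).
set a := inner M rho (curvature_defect M n 0 f).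
have E k : inner M rho (curvature_defect M n k f) = a - k * b.
  rewrite -mulNr -innerDZr; apply: eq_bigr => x _.
  by rewrite /curvature_defect; ring.
have b0 : 0 <= b by apply: inner_ge0 => // x; apply: Gamma_ge0.
have le_ab k : curvature_dimension M n k -> k * b <= a.
  by move=> /(_ rho f rho0); rewrite E subr_ge0.
rewrite E subr_ge0.
move: b0; rewrite le_eqVlt => /orP[/eqP b0|b0].
  have [[k /le_ab]|none] := pselect (exists k, curvature_dimension M n k).
    by rewrite -b0 !mulr0.
  suff : curvature M n = -oo%E by rewrite curvK.
  apply/eqP; rewrite -leeNy_eq; apply: ge_ereal_sup => _ [k hk <-].
  by case: none; exists k.
rewrite -ler_pdivlMr // -lee_fin -curvK.
apply: ge_ereal_sup => _ [k /le_ab hk <-].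
by rewrite lee_fin ler_pdivlMr.
Qed.

(** Evaluated at [rho = 1], the attained curvature bound reads as a spectral
    inequality. *)
Lemma energy_ge0 K f : curvature M +oo%E = K%:E ->
  0 <= inner M (D f) (D f) + K * inner M f (D f).
Proof.
by move=> /curvature_attained cK; rewrite -inner_one_defect; apply: cK.
Qed.

(** * Equality cases and eigenfunctions *)

Lemma quadratic_ge0_linear_eq0 (a b : R) :
  (forall t, 0 <= 2 * t * b + t ^+ 2 * a) -> b = 0.
Proof.
move=> H; set c := `|a| + 1.
have c0 : 0 < c by rewrite ltr_wpDl.
have ac : a < c by rewrite ltr_pwDr // ler_norm.
(* The vertex of the parabola is [- b / a]; enlarging [a] to [c > 0] keeps the
   value strictly negative unless [b = 0]. *)
have := H (- b / c).
have -> : 2 * (- b / c) * b + (- b / c) ^+ 2 * a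
    = b ^+ 2 / c ^+ 2 * (a - 2 * c) by field; rewrite gt_eqF.
rewrite nmulr_lge0; last by lra.
rewrite ler_pdivrMr ?exprn_gt0 // mul0r => b2.
by apply/eqP; rewrite -sqrf_eq0 eq_le b2 sqr_ge0.
Qed.

(** A vector at which a nonnegative quadratic form vanishes is in the radical
    of the form.  Self-adjointness identifies the pairing of [f] with [h] as
    the inner product of [D (D f) + K D f] with [h]. *)
Lemma defect_radical K f :
  (forall g, 0 <= inner M (D g) (D g) + K * inner M g (D g)) ->
  inner M (D f) (D f) + K * inner M f (D f) = 0 ->
  forall x, - D (D f) x = K * D f x.
Proof.
move=> pos Ef.
pose h x := D (D f) x + K * D f x.
suff h0 : forall x, h x = 0.
  by move=> x; apply/eqP; rewrite eq_sym -addr_eq0 addrC; apply/eqP/h0.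
apply: inner_self_eq0.
have cross : inner M h h = inner M (D f) (D h) + K * inner M f (D h).
  rewrite laplacian_selfadjoint [inner M f (D h)]laplacian_selfadjoint.
  by rewrite !(innerC _ h) -innerDZr.
clearbody h.
apply: (@quadratic_ge0_linear_eq0 (inner M (D h) (D h) + K * inner M h (D h))).
move=> t; have := pos (fun x => f x + t * h x).
have -> : D (fun x => f x + t * h x) = (fun x => D f x + t * D h x).
  by apply/funext => x; rewrite laplacianDZ.
have EC g k u : inner M (fun x => g x + t * k x) u
    = inner M g u + t * inner M k u by rewrite innerC innerDZr !(innerC u).
rewrite !EC !innerDZr.
have cross' : inner M (D h) (D f) = inner M (D f) (D h) by rewrite innerC.
have cross'' : inner M h (D f) = inner M f (D h).
  by rewrite laplacian_selfadjoint innerC.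
rewrite cross' cross'' cross.
set A := inner M (D f) (D f) in Ef *; set B := inner M f (D f) in Ef *.
have -> : A = - (K * B) by apply/eqP; rewrite -addr_eq0 Ef.
by congr (_ <= _); ring.
Qed.

Lemma eigen_energy l K f : (forall x, - D f x = l * f x) ->
  inner M (D f) (D f) + K * inner M f (D f) = l * (l - K) * inner M f f.
Proof.
move=> Df; rewrite /inner !mulr_sumr -big_split; apply: eq_bigr => x _ /=.
have -> : D f x = - (l * f x) by rewrite -Df opprK.
by ring.
Qed.

(** At an eigenfunction the zeroth order terms of the defect cancel. *)
Lemma eigen_defect l f x : (forall x, - D f x = l * f x) ->
  curvature_defect M +oo%E l f x = D (Gamma M f f) x / 2.
Proof.
move=> Df; rewrite curvature_defect_oo /Gamma2.
have -> : D f = (fun y => - l * f y).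
  by apply/funext => y; rewrite mulNr -Df opprK.
by rewrite GammaZr; field.
Qed.

(** * Sharpness and optimality *)

Lemma sharp_optimal : lichnerowicz_sharp M -> optimal M +oo%E one.
Proof.
move=> [l [[l0 [f [[x0 fx0] Df]] _] curvl]].
split; first by move=> x; apply: ler01.
have I0 : inner M one (curvature_defect M +oo%E l f) = 0.
  by rewrite inner_one_defect (eigen_energy _ Df) subrr mulr0 mul0r.
have d0 : forall x, curvature_defect M +oo%E l f x = 0.
  apply: inner_one_eq0 I0 => x.
  (* Testing the curvature bound against a point mass localizes it. *)
  have dirac_ge0 (y : X) : 0 <= (y == x)%:R :> R by exact: ler0n.
  have := curvature_attained (esym curvl) f dirac_ge0.
  rewrite /inner (bigD1 x) //= big1 ?addr0 => [|y /negPf ->]; last first.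
    by rewrite !mul0r.
  by rewrite eqxx mul1r pmulr_lge0 ?mc_pi_gt0.
have Gconst : forall x y, Gamma M f f x = Gamma M f f y.
  apply: harmonic_const => x; move: (d0 x); rewrite (eigen_defect _ Df).
  by move/eqP; rewrite mulf_eq0 invr_eq0 pnatr_eq0 orbF => /eqP.
exists l, f; split=> // x _.
rewrite lt_neqAle Gamma_ge0 andbT eq_sym; apply/eqP => Gx0.
have /laplacian_const/(_ x0) Df0 : forall x y, f x = f y.
  by apply: Gamma_eq0_const => y; rewrite (Gconst y x).
move: (Df x0); rewrite Df0 oppr0 => /esym/eqP.
by rewrite mulf_eq0 (gt_eqF l0) (negPf fx0).
Qed.

Lemma optimal_sharp : optimal M +oo%E one -> lichnerowicz_sharp M.
Proof.
move=> [_ [K [f [curvK Gf I0]]]].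
have pos g := energy_ge0 g curvK.
rewrite inner_one_defect in I0.
have Ef : 0 < - inner M f (D f).
  by rewrite -inner_one_Gamma; apply: inner_gt0_one => x; apply/Gf/ltr01.
have [x Dfx] : exists x, D f x != 0.
  apply/not_existsP => Df0; move: Ef; rewrite /inner big1 ?oppr0 ?ltxx //.
  by move=> x _; have /negP/negPn/eqP -> := Df0 x; rewrite mulr0 mul0r.
have Dff := inner_self_gt0 Dfx.
exists K; split=> //; split.
- by rewrite -(pmulr_lgt0 _ Ef) mulrN -(addr0_eq I0) // opprK.
- exists (D f); split; first by exists x.
  exact: defect_radical.
- move=> l l0 [g [[y gy] Dg]].
  have gg := inner_self_gt0 gy.
  have := pos g; rewrite (eigen_energy _ Dg).
  by rewrite pmulr_lge0 // pmulr_rge0 // subr_ge0.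
Qed.

End MarkovChain.

Theorem proposition4p3 (R : realType) (X : finType) (M : markov_chain R X) :
  lichnerowicz_sharp M <-> optimal M (+oo)%E (fun _ : X => 1%R).
Proof. by split; [apply: sharp_optimal | apply: optimal_sharp]. Qed.
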